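(* Let $n \geq 2$ be an integer and let $L$ be a totally real Galois extension of $\mathbb{Q}$ with $\operatorname{Gal}(L/\mathbb{Q}) \cong (\mathbb{Z}/2\mathbb{Z})^n$. Then for every nonzero $w \in \bigwedge^2 \operatorname{LOG}(\mathcal{O}_L^* )$, \[ \|w\|_1 \geq 2 \log\left(\frac{1+\sqrt{5}}{2}\right)\log(1+\sqrt{2}) \approx 0.8483 . \]
   Context: For a number field $L$, let $\mathcal{A}_L$ be its set of Archimedean places and $\mathcal{O}_L^*$ its unit group. Define $\operatorname{LOG}:\mathcal{O}_L^* \to \mathbb{R}^{\mathcal{A}_L}$ by $(\operatorname{LOG}(\gamma))_v = e_v \log|\gamma|_v$, where $e_v=1$ if $v$ is real and $e_v=2$ if $v$ is complex, and $|\cdot|_v$ is the absolute value associated to $v$ extending the usual absolute value on $\mathbb{Q}$. Let $\{\delta^v\}_{v\in\mathcal{A}_L}$ be the standard orthonormal basis of $\mathbb{R}^{\mathcal{A}_L}$; for each $2$-element subset $I=\{v_1,v_2\}$ of $\mathcal{A}_L$ (with a fixed ordering) put $\delta^I=\delta^{v_1}\wedge\delta^{v_2}$, giving a basis of $\bigwedge^2\mathbb{R}^{\mathcal{A}_L}$. For $w=\sum_I c_I\delta^I$, define $\|w\|_1=\sum_I |c_I|$. $\bigwedge^2\operatorname{LOG}(\mathcal{O}_L^* )$ denotes the subgroup of $\bigwedge^2\mathbb{R}^{\mathcal{A}_L}$ generated by all $\operatorname{LOG}(\epsilon_1)\wedge\operatorname{LOG}(\epsilon_2)$ with $\epsilon_1,\epsilon_2\in\mathcal{O}_L^*$.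 *)

(* Defs.v *)
From HB Require Import structures.
From mathcomp Require Import all_boot all_order all_algebra all_fingroup all_solvable all_field.
From mathcomp Require Import complex.
From mathcomp Require Import reals exp.
Set Implicit Arguments. Unset Strict Implicit. Unset Printing Implicit Defensive.
Import Order.TTheory GRing.Theory Num.Theory.
Local Open Scope ring_scope.

Definition integral (L : fieldType) (x : L) : Prop :=
  exists2 p : {poly int}, p \is monic & root (map_poly intr p) x.

Definition unit_of_OL (L : fieldType) (x : L) : Prop :=
  x != 0 /\ integral x /\ integral x^-1.

Definition totally_real (R : rcfType) (L : fieldType) : Prop :=
  forall (f : {rmorphism L -> R[i]}) (x : L), 'Im (f x) = 0.

(* Archimedean places of a totally real field L are exactly its real embeddings
   L -> R (e_v = 1 for all of them).  We index them by a finite type P via a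
   bijection [emb] onto the set of ring morphisms L -> R. *)
Definition indexes_places (R : realType) (L : fieldType) (P : finType)
  (emb : P -> {rmorphism L -> R}) : Prop :=
  and (forall p q, (forall x, emb p x = emb q x) -> p = q)
      (forall f : {rmorphism L -> R}, exists p, forall x, emb p x = f x).

(* LOG(gamma)_v = e_v log |gamma|_v, with e_v = 1 (real places) *)
Definition LOG (R : realType) (L : fieldType) (P : finType)
  (emb : P -> {rmorphism L -> R}) (x : L) : P -> R :=
  fun p => ln `|emb p x|.

(* Elements of /\^2 R^P represented by their coordinates c(u,v) on
   delta^u /\ delta^v (for all ordered pairs; antisymmetric). *)
Definition wedge2 (R : realType) (P : finType) (x y : P -> R) : P -> P -> R :=
  fun u v => x u * y v - x v * y u.

(* ||w||_1 = sum over 2-element subsets I = {u,v} (ordered u before v) of |c_I| *)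
Definition wedge_l1norm (R : realType) (P : finType) (w : P -> P -> R) : R :=
  \sum_(u : P) \sum_(v : P | (enum_rank u < enum_rank v)%N) `|w u v|.

Inductive wedge2_LOG_units (R : realType) (L : fieldType) (P : finType)
  (emb : P -> {rmorphism L -> R}) : (P -> P -> R) -> Prop :=
| W2_gen (e1 e2 : L) : unit_of_OL e1 -> unit_of_OL e2 ->
    wedge2_LOG_units emb (wedge2 (LOG emb e1) (LOG emb e2))
| W2_zero : wedge2_LOG_units emb (fun _ _ => 0)
| W2_sub (w1 w2 : P -> P -> R) : wedge2_LOG_units emb w1 -> wedge2_LOG_units emb w2 ->
    wedge2_LOG_units emb (fun u v => w1 u v - w2 u v).

(* Main.v *)
(** Let G be the Galois group.  The places form a G-torsor, so w can be paired
    with the quadratic characters c, d of G: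
      T(c, d) = sum over (u, v) of w(u, v) c(u) d(v).
    As w is antisymmetric and |c(u) d(v)| = 1, |T(c, d)| <= 2 ||w||_1; and T(c, d)
    is nonzero for some c <> d when w is, by Fourier inversion on (Z/2)^n.
    The pairing of LOG(e) with c is 2 log |N_c(e)|, where N_c(e) is the relative
    norm to the quadratic field cut out by c: a real y with y y' = 1 or -1 and
    y + y' an integer.  Such values log |y| are 0, or +-log of the golden ratio, or
    at least log(1 + sqrt 2) in absolute value.  They hence form a cyclic group, so
    T(c, d) is an integer multiple of 4 log|y| log|z| for generators y and z.  The
    golden ratio cannot occur for both c and d, as it would then lie in two distinct
    quadratic fields. *)
Require Import Defs.
From HB Require Import structures.
From mathcomp Require Import all_boot all_order all_algebra all_fingroup all_solvable all_field.
From mathcomp Require Import complex.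
From mathcomp Require Import reals exp.
From mathcomp Require Import ring lra zify.
Import Order.TTheory GRing.Theory Num.Theory.
Set Implicit Arguments. Unset Strict Implicit. Unset Printing Implicit Defensive.
Local Open Scope ring_scope.

(** * Integral elements and units of a field *)

Lemma integralM (K : fieldType) (x y : K) :
  integral x -> integral y -> integral (x * y).
Proof. exact: (@integral_mul _ _ intr). Qed.

Lemma integralD (K : fieldType) (x y : K) :
  integral x -> integral y -> integral (x + y).
Proof. exact: (@integral_add _ _ intr). Qed.

Lemma integral_rmorphism (K K' : fieldType) (f : {rmorphism K -> K'}) (x : K) :
  integral x -> integral (f x).
Proof.
case=> p mon_p px0; exists p => //.
have -> : map_poly intr p = map_poly f (map_poly intr p) :> {poly K'}.
  by rewrite -map_poly_comp; apply: eq_map_poly => z; rewrite /= rmorph_int.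
exact: rmorph_root.
Qed.

Lemma integral_prod (K : fieldType) (I : finType) (Q : pred I) (F : I -> K) :
  (forall i, Q i -> integral (F i)) -> integral (\prod_(i | Q i) F i).
Proof.
move=> intF; elim/big_ind: _ => //; last exact: integralM.
exact: (@integral1 _ _ intr).
Qed.

(** Z is integrally closed in Q; the fact is imported from [algC], where rational algebraic integers
    are known to be integers. *)
Lemma integral_rat_int (q : rat) : integral q -> exists m : int, q = m%:~R.
Proof.
move=> int_q; have [p mon_p pq0] := integral_rmorphism (@ratr algC) int_q.
have /Cint_rat_Aint : (ratr q : algC) \in Crat by apply: Crat_rat.
move=> /(_ (root_monic_Aint pq0 _ _)) h.
have /intrP[m qm] : (ratr q : algC) \is a Num.int.
  apply: h; first by rewrite monic_map.
  by apply/polyOverP => i; rewrite coef_map /= intr_int.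
exists m; apply: (fmorph_inj (@ratr algC)); by rewrite rmorph_int.
Qed.

Lemma unit_of_OL_M (K : fieldType) (x y : K) :
  unit_of_OL x -> unit_of_OL y -> unit_of_OL (x * y).
Proof.
move=> [x0 [ix ixV]] [y0 [iy iyV]]; split; first by rewrite mulf_neq0.
by rewrite invfM; split; apply: integralM.
Qed.

Lemma unit_of_OL_V (K : fieldType) (x : K) : unit_of_OL x -> unit_of_OL x^-1.
Proof. by move=> [x0 [ix ixV]]; split; rewrite ?invr_eq0 ?invrK. Qed.

Lemma unit_of_OL_1 (K : fieldType) : unit_of_OL (1 : K).
Proof.
have i1 : integral (1 : K) by exact: (@integral1 _ _ intr).
by split; [rewrite oner_eq0 | rewrite invr1].
Qed.

Lemma unit_of_OL_rmorphism (K K' : fieldType) (f : {rmorphism K -> K'}) (x : K) :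
  unit_of_OL x -> unit_of_OL (f x).
Proof.
move=> [x0 [ix ixV]]; split; first by rewrite fmorph_eq0.
by rewrite -fmorphV; split; apply: integral_rmorphism.
Qed.

Lemma unit_of_OL_prod (K : fieldType) (I : finType) (Q : pred I) (F : I -> K) :
  (forall i, Q i -> unit_of_OL (F i)) -> unit_of_OL (\prod_(i | Q i) F i).
Proof.
move=> uF; elim/big_ind: _ => //; [exact: unit_of_OL_1 | exact: unit_of_OL_M].
Qed.

Lemma integral_rat_alg (K : fieldExtType rat) (q : rat) :
  integral (q%:A : K) -> exists m : int, q = m%:~R.
Proof.
move=> [p mon_p pq0]; apply: integral_rat_int; exists p => //.
rewrite -(fmorph_root (in_alg K)) -map_poly_comp.
suff -> : map_poly (in_alg K \o intr) p = map_poly intr p by [].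
by apply: eq_map_poly => z; rewrite -[LHS]/(in_alg K z%:~R) rmorph_int.
Qed.

(** * Galois-invariant elements, and embeddings as Galois conjugates *)

Lemma mem_gal1 (L : splittingFieldType rat) (g : gal_of {:L}) :
  g \in 'Gal({:L} / 1)%g.
Proof.
rewrite gal_kHom ?sub1v //; apply/kHomP; split; first by move=> x y *; exact: rmorphM.
by move=> _ /vlineP[k ->]; rewrite linearZ rmorph1.
Qed.

Lemma galois_fixed_rat (L : splittingFieldType rat) (x : L) :
  galois (1%VS : {vspace L}) fullv ->
  (forall g : gal_of {:L}, g x = x) -> exists q : rat, x = q%:A.
Proof.
move=> galL gx; apply/vlineP.
have <- : fixedField 'Gal({:L} / 1)%g = 1%VS := galois_fixedField galL.
by apply/fixedFieldP; rewrite ?memvf // => g _; apply: gx.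
Qed.

Lemma fixed_integral_int (L : splittingFieldType rat) (x : L) :
  galois (1%VS : {vspace L}) fullv -> integral x ->
  (forall g : gal_of {:L}, g x = x) -> exists m : int, x = m%:~R.
Proof.
move=> galL int_x /(galois_fixed_rat galL)[q def_x].
rewrite def_x in int_x *; have [m ->] := integral_rat_alg int_x.
by exists m; rewrite -in_algE rmorph_int.
Qed.

(** Both [x] and its inverse are invariant and integral, hence integers with product 1. *)
Lemma fixed_unit_pm1 (L : splittingFieldType rat) (x : L) :
  galois (1%VS : {vspace L}) fullv -> unit_of_OL x ->
  (forall g : gal_of {:L}, g x = x) -> x = 1 \/ x = -1.
Proof.
move=> galL [x0 [ix ixV]] gx.
have [m xm] := fixed_integral_int galL ix gx.
have [k xk] : exists k : int, x^-1 = k%:~R.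
  by apply: fixed_integral_int galL ixV _ => g; rewrite -[in RHS](gx g); apply: fmorphV.
have : (m * k)%:~R = 1%:~R :> L by rewrite rmorphM /= -xm -xk divff.
rewrite xm.
have inj : injective (intr : int -> L).
  move=> a b; rewrite -!(rmorph_int (in_alg L)) => /fmorph_inj/eqP.
  by rewrite eqr_int => /eqP.
move/inj => mk1.
have /eqP := congr1 absz mk1; rewrite abszM muln_eq1 => /andP[/eqP m1 _].
have : m = 1 \/ m = -1 by lia.
by case=> ->; [left | right].
Qed.

(** Embeddings are given as ring morphisms, so agreement on Q comes from writing a rational as a
    quotient of integers. *)
Lemma rmorphism_alg_rat (K : fieldExtType rat) (F : fieldType)
  (f h : {rmorphism K -> F}) (q : rat) : f q%:A = h q%:A.
Proof.
have ratE (e : {rmorphism K -> F}) : e q%:A = (numq q)%:~R / (denq q)%:~R.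
  rewrite -[in LHS](divq_num_den q) -in_algE.
  by rewrite [LHS](fmorph_div (e \o in_alg K)) !rmorph_int.
by rewrite !ratE.
Qed.

Lemma rmorphism_poly1 (L : fieldExtType rat) (F : fieldType)
  (f h : {rmorphism L -> F}) (p : {poly L}) :
  p \is a polyOver 1%VS -> map_poly f p = map_poly h p.
Proof.
move=> /polyOverP p1; apply/polyP => i; rewrite !coef_map /=.
by have /vlineP[k ->] := p1 i; apply: rmorphism_alg_rat.
Qed.

(* The embeddings agree on the minimal polynomial of a primitive element z, all
   of whose roots are Galois conjugates of z. *)
Lemma embedding_galois_conj (L : splittingFieldType rat) (F : fieldType)
  (f h : {rmorphism L -> F}) :
  galois (1%VS : {vspace L}) fullv ->
  exists g : gal_of {:L}, forall x, h x = f (g x).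
Proof.
move=> galL; have /and3P[_ sepL _] := galL.
pose z := separable_generator 1%VS {:L}.
have defL : {:L}%VS = <<1; z>>%VS := eq_adjoin_separable_generator sepL (sub1v _).
have [r [_ _ def_r]] := galois_factors (sub1v _) galL _ (memvf z).
have : root (map_poly h (minPoly 1 z)) (h z) by rewrite rmorph_root ?root_minPoly.
rewrite (rmorphism_poly1 h f (minPolyOver 1 z)) def_r rmorph_prod /= big_map.
under eq_bigr => g _ do rewrite /= map_polyXsubC.
rewrite -(big_map (fun g : gal_of {:L} => f (g z)) xpredT (fun b => 'X - b%:P)).
rewrite root_prod_XsubC => /mapP[g _ hz]; exists g => x.
have /Fadjoin_polyP[p p1 ->] : x \in <<1; z>>%VS by rewrite -defL memvf.
rewrite -!horner_map /= hz (rmorphism_poly1 h (f \o g) p1).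
by rewrite map_poly_comp /=.
Qed.

(** * Discrete subgroups of the real line *)

Lemma discrete_subgroup_cyclic (R : realType) (S : R -> Prop) (c : R) :
  0 < c -> S 0 -> (forall x y, S x -> S y -> S (x - y)) ->
  (forall x, S x -> x != 0 -> c <= `|x|) ->
  exists2 s, S s & forall x, S x -> exists m : int, x = m%:~R * s.
Proof.
move=> c0 S0 SB Sc.
have SN x : S x -> S (- x) by move=> Sx; rewrite -sub0r; apply: SB.
have [[s1 Ss1 s1N0]|noS] := boolp.pselect (exists2 x, S x & x != 0); last first.
  exists 0 => // x Sx; exists 0; rewrite mulr0; apply/eqP.
  by apply: contra_notT noS => x0; exists x.
have [s [Ss s0 smin]] : exists s, [/\ S s, 0 < s & forall x, S x -> 0 < x -> s <= x].
  have {s1 Ss1 s1N0} [s1 Ss1 s10] : exists2 x, S x & 0 < x.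
    by exists `|s1|; rewrite ?normr_gt0 //; case: (ger0P s1) => // _; apply: SN.
  have [N] : exists N : nat, s1 <= N%:R * c.
    exists (Num.Def.archi_bound (s1 / c)); rewrite -ler_pdivrMr //.
    by apply/ltW/archi_boundP/divr_ge0; apply: ltW.
  (* Descent to a least positive element: distinct elements of [S] are at least [c] apart, so each
     smaller positive element lowers the bound [N * c] by one [c]. *)
  elim: N s1 Ss1 s10 => [|N IHN] s Ss s0 sN; first by exfalso; lra.
  have [[x [Sx x0 xs]]|min] := boolp.pselect (exists x, [/\ S x, 0 < x & x < s]).
    apply: (IHN x) => //.
    have := Sc _ (SB _ _ Ss Sx); rewrite subr_eq0 gt_eqF // gtr0_norm ?subr_gt0 //.
    by move=> /(_ isT); move: sN; rewrite -natr1; lra.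
  exists s; split=> // x Sx x0; rewrite leNgt; apply/negP => xs.
  by apply: min; exists x.
have SZ (m : int) x : S x -> S (m%:~R * x).
  move=> Sx; have SMn k : S (k%:R * x).
    elim: k => [|k IHk]; first by rewrite mul0r.
    by have -> : k.+1%:R * x = k%:R * x - (- x); [rewrite -natr1; ring | apply/SB/SN].
  case: m => k; first exact: SMn.
  by rewrite NegzE mulrNz mulNr; apply/SN/SMn.
(* Euclidean division by [s]: the remainder lies in [S] and in [0, s), so minimality of [s] makes it
   0. *)
exists s => // x Sx; exists (Num.floor (x / s)).
have /andP[] := floor_itv (x / s).
set m := Num.floor _; rewrite intrD ler_pdivlMr // ltr_pdivrMr // => le_x lt_x.
apply/eqP; rewrite -subr_eq0 eq_le subr_ge0 le_x andbT leNgt; apply/negP => d0.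
by have := smin _ (SB _ _ Sx (SZ m _ Ss)) d0; lra.
Qed.

(** * Small units of real quadratic fields *)

Section QuadraticUnits.
Variable R : realType.
Implicit Types y z : R.

Lemma sqrt2_spec :
  [/\ Num.sqrt 2 * Num.sqrt 2 = 2 :> R, 1 < Num.sqrt 2 :> R & Num.sqrt 2 < 3 / 2 :> R].
Proof.
have sqE : Num.sqrt 2 * Num.sqrt 2 = 2 :> R by rewrite -expr2 sqr_sqrtr.
have := sqrtr_ge0 (2 : R); split=> //; nra.
Qed.

Lemma sqrt5_spec :
  [/\ Num.sqrt 5 * Num.sqrt 5 = 5 :> R, 2 < Num.sqrt 5 :> R & Num.sqrt 5 < 5 / 2 :> R].
Proof.
have sqE : Num.sqrt 5 * Num.sqrt 5 = 5 :> R by rewrite -expr2 sqr_sqrtr.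
have := sqrtr_ge0 (5 : R); split=> //; nra.
Qed.

Lemma ln_golden_gt0 : 0 < ln ((1 + Num.sqrt 5) / 2) :> R.
Proof. by have [_ ? _] := sqrt5_spec; apply: ln_gt0; lra. Qed.

Lemma ln_golden_le_silver :
  ln ((1 + Num.sqrt 5) / 2) <= ln (1 + Num.sqrt 2) :> R.
Proof.
have [_ ? ?] := sqrt5_spec; have [_ ? _] := sqrt2_spec.
by rewrite ler_ln ?posrE; lra.
Qed.

(** Here [y] is the larger root of Y^2 - t Y + 1 or Y^2 - t Y - 1, and it grows with the trace [t],
    so only the smallest traces matter. *)
Lemma quadratic_unit_gt1 y z (t : int) :
  1 < y -> y * z = 1 \/ y * z = -1 -> y + z = t%:~R ->
  y = (1 + Num.sqrt 5) / 2 \/ 1 + Num.sqrt 2 <= y.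
Proof.
move=> y1 yz ytz.
have [s2 s2l s2u] := sqrt2_spec; have [s5 s5l s5u] := sqrt5_spec.
have def_y : y * y + y * z = t%:~R * y by rewrite -ytz; ring.
case: yz => yz; rewrite yz in def_y.
  (* Norm 1: y + 1/y > 2 forces t >= 3, and then y >= (3 + sqrt 5)/2 > 1 + sqrt 2. *)
  have t3 : 3 <= t.
    have : 2%:~R < t%:~R :> R by rewrite -ytz; nra.
    by rewrite ltr_int; lia.
  have {}t3 : 3%:~R <= t%:~R :> R by rewrite ler_int.
  by right; nra.
(* Norm -1: t = y - 1/y is positive. Trace 1 gives the golden ratio, trace 2 gives 1 + sqrt 2, and
   larger traces give more. *)
have t0 : 0 < t.
  have : 0%:~R < t%:~R :> R by nra.
  by rewrite ltr_int.
have [t1|t2] : t = 1 \/ 2 <= t by lia.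
  left; have : (y - (1 + Num.sqrt 5) / 2) * (y - (1 - Num.sqrt 5) / 2) = 0.
    by rewrite t1 in def_y; nra.
  by move/eqP; rewrite mulf_eq0 => /orP[/eqP|/eqP]; nra.
have {}t2 : 2%:~R <= t%:~R :> R by rewrite ler_int.
by right; nra.
Qed.

(** Reduces to [y] > 1: a sign change of both conjugates keeps the norm and negates the trace, and
    exchanging the conjugates inverts the absolute value. *)
Lemma quadratic_unit_ln y z (t : int) :
  y * z = 1 \/ y * z = -1 -> y + z = t%:~R -> ln `|y| != 0 ->
  `|ln `|y| | = ln ((1 + Num.sqrt 5) / 2) \/ ln (1 + Num.sqrt 2) <= `|ln `|y| |.
Proof.
have main y' z' (s : int) : 1 < `|y'| -> y' * z' = 1 \/ y' * z' = -1 ->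
    y' + z' = s%:~R ->
    `|ln `|y'| | = ln ((1 + Num.sqrt 5) / 2) \/ ln (1 + Num.sqrt 2) <= `|ln `|y'| |.
  move=> y1 yz ys; rewrite ger0_norm ?ln_ge0 ?(ltW y1) //.
  have [-> | h] : `|y'| = (1 + Num.sqrt 5) / 2 \/ 1 + Num.sqrt 2 <= `|y'|; [|by left|].
    case: (ger0P y') y1 => y0 y1.
      exact: quadratic_unit_gt1 y1 yz ys.
    apply: (@quadratic_unit_gt1 _ (- z') (- s)) => //; first by rewrite mulrNN.
    by rewrite -opprD ys mulrNz.
  by have [_ ? _] := sqrt2_spec; right; rewrite ler_ln ?posrE //; lra.
move=> yz ys lny.
have yzn : `|y| * `|z| = 1 by rewrite -normrM; case: yz => ->; rewrite ?normrN normr1.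
have y0 : 0 < `|y|.
  rewrite lt0r normr_ge0 andbT; apply: contra_eq_neq yzn => ->.
  by rewrite mul0r eq_sym oner_eq0.
have [y1|y1|y1] := ltgtP `|y| 1; last by rewrite y1 ln1 eqxx in lny.
  have zV : `|z| = `|y|^-1 by rewrite -[LHS]mul1r -(mulVf (lt0r_neq0 y0)) -mulrA yzn mulr1.
  have <- : `|ln `|z| | = `|ln `|y| | by rewrite zV lnV ?posrE // normrN.
  apply: (main z y t); rewrite ?[z * y]mulrC ?[z + y]addrC //.
  by rewrite zV invf_gt1.
exact: main y1 yz ys.
Qed.

End QuadraticUnits.

(** * Characters of (Z/2)^n and Fourier inversion *)

Section Characters.
Variable R : realType.

Definition sgnZ2 (z : 'Z_2) : R := if z == 0 then 1 else -1.

Lemma sgnZ2D z t : sgnZ2 (z + t) = sgnZ2 z * sgnZ2 t.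
Proof.
case: z => [[|[|z]] ltz] //; case: t => [[|[|t]] ltt] //.
- by rewrite /sgnZ2 /= mul1r.
- by rewrite /sgnZ2 /= mul1r.
- by rewrite /sgnZ2 /= mulr1.
- by rewrite /sgnZ2 /= mulrNN mul1r.
Qed.

Variable n : nat.
Implicit Types a b x y : 'rV['Z_2]_n.

(** The dot product identifies the group with its own dual, so that characters are indexed by row
    vectors and [chi] is symmetric. *)
Definition chi a x : R := sgnZ2 (\sum_i a 0 i * x 0 i).

Lemma chiC a x : chi a x = chi x a.
Proof. by congr sgnZ2; apply: eq_bigr => i _; rewrite mulrC. Qed.

Lemma chiD a x y : chi a (x + y) = chi a x * chi a y.
Proof.
rewrite /chi -sgnZ2D -big_split /=; congr sgnZ2.
by apply: eq_bigr => i _; rewrite mxE mulrDr.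
Qed.

Lemma chi_pm1 a x : chi a x = 1 \/ chi a x = -1.
Proof. by rewrite /chi /sgnZ2; case: ifP; [left | right]. Qed.

Lemma chi0 a : chi a 0 = 1.
Proof. by rewrite /chi big1 // => i _; rewrite mxE mulr0. Qed.

Lemma chiB a x y : chi a (x - y) = chi a x * chi a y.
Proof.
have: chi a (x - y) * chi a y = chi a x by rewrite -chiD subrK.
by move=> <-; case: (chi_pm1 a y) => ->; ring.
Qed.

(** Translating [a] by the basis vector of a nonzero coordinate of [x] negates every term. *)
Lemma sum_chi_eq0 x : x != 0 -> \sum_a chi a x = 0.
Proof.
move=> /rV0Pn[i xi].
suff flip : \sum_a chi a x = - \sum_a chi a x by lra.
rewrite [LHS](reindex_inj (addrI (delta_mx 0 i))) -sumrN; apply: eq_bigr => a _.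
rewrite chiC chiD chiC (chiC x a) -[RHS]mulN1r; congr (_ * _).
rewrite /chi (bigD1 i) //= big1 ?addr0 => [|j ji]; last first.
  by rewrite mxE eqxx (negbTE ji) mul0r.
by rewrite mxE !eqxx mul1r /sgnZ2 (negbTE xi).
Qed.

(** Fourier inversion: multiplying by [chi a (h t0)] and summing over [a] leaves only the term of
    [t0], times the number of characters. *)
Lemma chi_separates (T : finType) (h : T -> 'rV['Z_2]_n) (F : T -> R) :
  injective h -> (forall a, \sum_t F t * chi a (h t) = 0) -> forall t, F t = 0.
Proof.
move=> inj_h F0 t0.
have : \sum_a (\sum_t F t * chi a (h t)) * chi a (h t0) = 0.
  by apply: big1 => a _; rewrite F0 mul0r.
under eq_bigr => a _ do rewrite mulr_suml.
rewrite exchange_big /= (bigD1 t0) //= [X in _ + X]big1 ?addr0 => [|t t_t0]; last first.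
  under eq_bigr => a _ do rewrite -mulrA -chiB.
  by rewrite -mulr_sumr sum_chi_eq0 ?mulr0 // subr_eq0 (inj_eq inj_h).
under eq_bigr => a _ do rewrite -mulrA -chiB subrr chi0 mulr1.
move/eqP; rewrite sumr_const mulrn_eq0 => /orP[|/eqP //].
by rewrite -leqn0 leqNgt; case/negP; apply/card_gt0P; exists 0.
Qed.

End Characters.

(** * Relative norms to quadratic subfields and their logarithms *)

Lemma ln_norm_prod (R : realType) (I : finType) (Q : pred I) (F : I -> R) :
  (forall i, F i != 0) -> ln `|\prod_(i | Q i) F i| = \sum_(i | Q i) ln `|F i|.
Proof.
move=> F0; suff [] : ln `|\prod_(i | Q i) F i| = \sum_(i | Q i) ln `|F i|
    /\ 0 < `|\prod_(i | Q i) F i| by [].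
apply: (big_ind2 (fun x y : R => ln `|x| = y /\ 0 < `|x|)) => [|x a y b [<- x0] [<- y0]|i _].
- by rewrite normr1 ln1 ltr01.
- by rewrite normrM lnM ?posrE // mulr_gt0.
- by rewrite normr_gt0.
Qed.

Section RelativeNorms.
Variables (R : realType) (L : splittingFieldType rat) (f : {rmorphism L -> R}).
Hypothesis galL : galois (1%VS : {vspace L}) fullv.
Local Notation G := (gal_of {:L}).

(** The trivial character is included: for it [relnorm c 1] is the norm to Q and [relnorm c (-1)] is
    an empty product. *)
Definition quadratic_character (c : G -> R) : Prop :=
  (forall g, c g = 1 \/ c g = -1) /\ (forall g h, c (g * h)%g = c g * c h).

(* For a nontrivial c, [relnorm c 1] is the norm from L down to the quadratic
   field fixed by the kernel of c, and [relnorm c (-1)] is its conjugate. *)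
Definition relnorm (c : G -> R) (s : R) (e : L) : L := \prod_(g : G | c g == s) g e.

Definition logrel (c : G -> R) (e : L) : R := ln `|f (relnorm c 1 e)|.

Lemma quadratic_character_neq0 c g : quadratic_character c -> c g != 0.
Proof. by case=> /(_ g)[] -> _; rewrite ?oppr_eq0 oner_eq0. Qed.

Lemma relnorm_gal c s e (h : G) :
  quadratic_character c -> h (relnorm c s e) = relnorm c (c h * s) e.
Proof.
move=> qc; have [_ cM] := qc.
rewrite [LHS]rmorph_prod [RHS](reindex_inj (mulIg h)) /=.
apply: eq_big => g; last by rewrite galM ?memvf.
by rewrite cM mulrC (inj_eq (mulfI (quadratic_character_neq0 h qc))).
Qed.

Lemma relnorm_unit c s e : unit_of_OL e -> unit_of_OL (relnorm c s e).
Proof. by move=> ue; apply: unit_of_OL_prod => g _; apply: unit_of_OL_rmorphism. Qed.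

(** Each Galois element either fixes the two relative norms or swaps them, so their product is an
    invariant unit. *)
Lemma relnorm_mul_conj c e : quadratic_character c -> unit_of_OL e ->
  relnorm c 1 e * relnorm c (-1) e = 1 \/ relnorm c 1 e * relnorm c (-1) e = -1.
Proof.
move=> qc ue; apply: (fixed_unit_pm1 galL).
  by apply: unit_of_OL_M; apply: relnorm_unit.
move=> h; rewrite [LHS]rmorphM /= !relnorm_gal //.
by case: (qc.1 h) => ->; rewrite ?mul1r ?mulrNN ?mulr1 // mulrC.
Qed.

Lemma relnorm_add_conj c e : quadratic_character c -> unit_of_OL e ->
  exists t : int, relnorm c 1 e + relnorm c (-1) e = t%:~R.
Proof.
move=> qc ue; apply: (fixed_integral_int galL).
  by apply: integralD; [have [_ []] := relnorm_unit c 1 ue | have [_ []] := relnorm_unit c (-1) ue].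
move=> h; rewrite [LHS]rmorphD /= !relnorm_gal //.
by case: (qc.1 h) => ->; rewrite ?mul1r ?mulrNN ?mulr1 // addrC.
Qed.

Lemma ln_relnorm c s e : unit_of_OL e ->
  ln `|f (relnorm c s e)| = \sum_(g : G | c g == s) ln `|f (g e)|.
Proof.
move=> [e0 _]; rewrite rmorph_prod ln_norm_prod // => g.
by rewrite fmorph_eq0 (fmorph_eq0 g).
Qed.

Lemma logrel_conj c e : quadratic_character c -> unit_of_OL e ->
  ln `|f (relnorm c (-1) e)| = - logrel c e.
Proof.
move=> qc ue; rewrite /logrel.
have [n1 _] := relnorm_unit c 1 ue; have [n2 _] := relnorm_unit c (-1) ue.
apply/eqP; rewrite -addr_eq0 addrC -lnM ?posrE ?normr_gt0 ?fmorph_eq0 //.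
rewrite -normrM -rmorphM.
by case: (relnorm_mul_conj qc ue) => ->; rewrite ?rmorphN rmorph1 ?normrN normr1 ln1.
Qed.

(** Splitting the sum by the sign of [c] gives the logarithm of one relative norm minus that of its
    conjugate, and these logarithms are opposite. *)
Lemma character_pairing c e : quadratic_character c -> unit_of_OL e ->
  \sum_(g : G) c g * ln `|f (g e)| = 2 * logrel c e.
Proof.
move=> qc ue; have := logrel_conj qc ue.
have -> : 2 * logrel c e = logrel c e - - logrel c e by ring.
move=> <-; rewrite /logrel !ln_relnorm // (bigID (fun g => c g == 1)) /=; congr (_ + _).
  by apply: eq_bigr => g /eqP ->; rewrite mul1r.
rewrite -sumrN; apply: eq_big => g.
  have neq1 : (1 == -1 :> R) = false by apply/negbTE/eqP; lra.
  by case: (qc.1 g) => ->; rewrite ?[-1 == 1]eq_sym neq1 eqxx.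
by case: (qc.1 g) => ->; rewrite ?eqxx // mulN1r.
Qed.

Lemma logrel_div c e1 e2 : unit_of_OL e1 -> unit_of_OL e2 ->
  logrel c (e1 / e2) = logrel c e1 - logrel c e2.
Proof.
move=> u1 u2; rewrite /logrel !ln_relnorm //; last exact/unit_of_OL_M/unit_of_OL_V.
rewrite -sumrB; apply: eq_bigr => g _.
have [e10 _] := u1; have [e20 _] := u2.
have -> : g (e1 / e2) = g e1 / g e2 by exact: fmorph_div.
by rewrite fmorph_div normf_div ln_div // posrE normr_gt0 fmorph_eq0 (fmorph_eq0 g).
Qed.

Lemma logrel_dichotomy c e : quadratic_character c -> unit_of_OL e -> logrel c e != 0 ->
  `|logrel c e| = ln ((1 + Num.sqrt 5) / 2) \/ ln (1 + Num.sqrt 2) <= `|logrel c e|.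
Proof.
move=> qc ue; have [t addE] := relnorm_add_conj qc ue.
apply: (@quadratic_unit_ln _ _ (f (relnorm c (-1) e)) t).
  rewrite -rmorphM.
  by case: (relnorm_mul_conj qc ue) => ->; rewrite ?rmorphN rmorph1; [left | right].
by rewrite -rmorphD addE rmorph_int.
Qed.

Lemma logrel_ge c e : quadratic_character c -> unit_of_OL e -> logrel c e != 0 ->
  ln ((1 + Num.sqrt 5) / 2) <= `|logrel c e|.
Proof.
move=> qc ue /(logrel_dichotomy qc ue)[->// | ].
exact: le_trans (ln_golden_le_silver R).
Qed.

(** The values of [logrel c] on units form a subgroup of the reals, in which nonzero elements are
    bounded below by the logarithm of the golden ratio. *)
Lemma logrel_cyclic c : quadratic_character c ->
  exists2 e0, unit_of_OL e0 &
    forall e, unit_of_OL e -> exists m : int, logrel c e = m%:~R * logrel c e0.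
Proof.
move=> qc; pose S r := exists2 e, unit_of_OL e & r = logrel c e.
have [||||_ [e0 ue0 ->] gen] :=
    @discrete_subgroup_cyclic R S (ln ((1 + Num.sqrt 5) / 2)).
- exact: ln_golden_gt0.
- exists 1; first exact: unit_of_OL_1.
  by rewrite -[1 in RHS](@mulfV _ 1) ?oner_eq0 // logrel_div ?subrr //; apply: unit_of_OL_1.
- move=> _ _ [e1 u1 ->] [e2 u2 ->]; exists (e1 / e2); first exact/unit_of_OL_M/unit_of_OL_V.
  by rewrite logrel_div.
- by move=> _ [e ue ->]; apply: logrel_ge.
by exists e0 => // e ue; apply: gen; exists e.
Qed.

(* Equal logarithms force the two relative norms to be equal up to sign and
   inversion, so g fixes both of them while inverting one up to sign. *)
Lemma logrel_indep c d g e1 e2 : quadratic_character c -> quadratic_character d ->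
  c g = 1 -> d g = -1 -> unit_of_OL e1 -> unit_of_OL e2 ->
  `|logrel c e1| = `|logrel d e2| -> logrel d e2 = 0.
Proof.
move=> qc qd cg dg u1 u2 eq_log.
suff fix2 : g (relnorm d 1 e2) = relnorm d 1 e2.
  have := logrel_conj qd u2.
  rewrite -[X in relnorm d X e2]mulr1 -dg -relnorm_gal // fix2 -/(logrel d e2); lra.
have fix1 : g (relnorm c 1 e1) = relnorm c 1 e1 by rewrite relnorm_gal // cg mulr1.
have fixV : g (relnorm c 1 e1)^-1 = (relnorm c 1 e1)^-1.
  by rewrite -[in RHS]fix1; apply: fmorphV.
have fixN x : g x = x -> g (- x) = - x by move=> gx; rewrite -[in RHS]gx; apply: rmorphN.
have [n1 _] := relnorm_unit c 1 u1; have [n2 _] := relnorm_unit d 1 u2.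
have ln_eq x y : x != 0 -> y != 0 -> ln `|f x| = ln `|f y| -> y = x \/ y = - x.
  move=> x0 y0 /ln_inj; rewrite !posrE !normr_gt0 !fmorph_eq0 => /(_ x0 y0)/esym/eqP.
  by rewrite eqr_norm2 -rmorphN !(inj_eq (fmorph_inj f)) => /orP[]/eqP; [left | right].
move/eqP: eq_log; rewrite eqr_norm2 => /orP[]/eqP eq_log.
  by have [-> | ->] := ln_eq _ _ n1 n2 eq_log; [ | apply: fixN].
have {}eq_log : ln `|f (relnorm c 1 e1)^-1| = ln `|f (relnorm d 1 e2)|.
  rewrite fmorphV normfV lnV ?posrE ?normr_gt0 ?fmorph_eq0 //.
  by rewrite -[LHS]/(- logrel c e1) eq_log opprK.
have nV : (relnorm c 1 e1)^-1 != 0 by rewrite invr_eq0.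
by have [-> | ->] := ln_eq _ _ nV n2 eq_log; [ | apply: fixN].
Qed.

(** Only the case of two golden ratios could violate the bound. There some [g] has sign 1 under one
    character and -1 under the other, and [logrel_indep] applies in the matching order. *)
Lemma logrel_mul_ge c d e1 e2 : quadratic_character c -> quadratic_character d ->
  (exists g, c g != d g) -> unit_of_OL e1 -> unit_of_OL e2 ->
  logrel c e1 != 0 -> logrel d e2 != 0 ->
  ln ((1 + Num.sqrt 5) / 2) * ln (1 + Num.sqrt 2) <= `|logrel c e1| * `|logrel d e2|.
Proof.
move=> qc qd [g cdg] u1 u2 n1 n2.
have g0 := ltW (ln_golden_gt0 R).
have s0 := le_trans g0 (ln_golden_le_silver R).
have ge1 := logrel_ge qc u1 n1; have ge2 := logrel_ge qd u2 n2.
have [eq1 | silver1] := logrel_dichotomy qc u1 n1; last by rewrite mulrC ler_pM.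
have [eq2 | silver2] := logrel_dichotomy qd u2 n2; last by rewrite ler_pM.
have eq12 := etrans eq1 (esym eq2).
case: (qc.1 g) (qd.1 g) cdg => cg [] dg; rewrite cg dg ?eqxx // => _.
  by rewrite (logrel_indep qc qd cg dg u1 u2 eq12) eqxx in n2.
by rewrite (logrel_indep qd qc dg cg u2 u1 (esym eq12)) eqxx in n1.
Qed.

End RelativeNorms.

(** * The l1 norm and the pairing of bivectors with pairs of functions *)

Lemma wedge_l1norm_twice (R : realType) (P : finType) (w : P -> P -> R) :
  (forall u v, w u v = - w v u) -> \sum_u \sum_v `|w u v| = 2 * wedge_l1norm w.
Proof.
move=> antiw; have w0 u : w u u = 0 by have := antiw u u; lra.
have -> : \sum_u \sum_v `|w u v| = wedge_l1norm w
    + \sum_u \sum_(v | (enum_rank v < enum_rank u)%N) `|w u v|.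
  rewrite /wedge_l1norm -big_split /=; apply: eq_bigr => u _.
  rewrite (bigID (fun v => (enum_rank u < enum_rank v)%N)) /=; congr (_ + _).
  rewrite (bigD1 u) ?ltnn //= w0 normr0 add0r; apply: eq_bigl => v.
  by rewrite -leqNgt ltn_neqAle (inj_eq val_inj) (inj_eq enum_rank_inj) andbC.
suff -> : \sum_u \sum_(v | (enum_rank v < enum_rank u)%N) `|w u v| = wedge_l1norm w by ring.
rewrite (exchange_big_dep xpredT) //=; apply: eq_bigr => u _; apply: eq_bigr => v _.
by rewrite antiw normrN.
Qed.

(** This is T(c, d) when [X] and [Y] are the characters c and d read on places. Both orders of a
    pair are summed, whence the factor 2 against the l1 norm. *)
Definition wpair (R : realType) (P : finType) (X Y : P -> R) (w : P -> P -> R) : R :=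
  \sum_u \sum_v w u v * (X u * Y v).

Lemma wpairB (R : realType) (P : finType) (X Y : P -> R) (w1 w2 : P -> P -> R) :
  wpair X Y (fun u v => w1 u v - w2 u v) = wpair X Y w1 - wpair X Y w2.
Proof.
rewrite /wpair -sumrB; apply: eq_bigr => u _; rewrite -sumrB; apply: eq_bigr => v _.
by rewrite mulrBl.
Qed.

(** On a decomposable bivector the pairing is the 2 by 2 determinant of the pairings of vectors. *)
Lemma wpair_wedge2 (R : realType) (P : finType) (X Y x y : P -> R) :
  wpair X Y (wedge2 x y) = (\sum_u X u * x u) * (\sum_u Y u * y u)
                         - (\sum_u X u * y u) * (\sum_u Y u * x u).
Proof.
rewrite /wpair !mulr_suml -sumrB; apply: eq_bigr => u _.
rewrite !mulr_sumr -sumrB; apply: eq_bigr => v _.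
by rewrite /wedge2; ring.
Qed.

Lemma wpair_le (R : realType) (P : finType) (X Y : P -> R) (w : P -> P -> R) :
  (forall u v, w u v = - w v u) ->
  (forall u, `|X u| = 1) -> (forall u, `|Y u| = 1) ->
  `|wpair X Y w| <= 2 * wedge_l1norm w.
Proof.
move=> antiw X1 Y1; rewrite -wedge_l1norm_twice //.
apply: (le_trans (ler_norm_sum _ _ _)); apply: ler_sum => u _.
apply: (le_trans (ler_norm_sum _ _ _)); apply: ler_sum => v _.
by rewrite !normrM X1 Y1 !mulr1.
Qed.

Lemma wpair_diag (R : realType) (P : finType) (X : P -> R) (w : P -> P -> R) :
  (forall u v, w u v = - w v u) -> wpair X X w = 0.
Proof.
move=> antiw; suff : wpair X X w = - wpair X X w by lra.
rewrite {1}/wpair exchange_big /= -sumrN; apply: eq_bigr => u _.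
rewrite -sumrN; apply: eq_bigr => v _.
by rewrite antiw; ring.
Qed.

Lemma wedge2_LOG_units_anti (R : realType) (L : fieldType) (P : finType)
  (emb : P -> {rmorphism L -> R}) w :
  wedge2_LOG_units emb w -> forall u v, w u v = - w v u.
Proof.
elim=> [e1 e2 _ _ | | w1 w2 _ IH1 _ IH2] u v; first by rewrite /wedge2; ring.
  by rewrite oppr0.
by rewrite IH1 IH2; ring.
Qed.

(** * Duality between places and characters, and the resulting bound *)

Theorem theorem1 (R : realType) (n : nat) (L : splittingFieldType rat)
  (P : finType) (emb : P -> {rmorphism L -> R}) :
  (2 <= n)%N ->
  galois (1%VS : {vspace L}) fullv ->
  ('Gal((fullv : {vspace L}) / 1%VS) \isog [set: 'rV['Z_2]_n])%g ->
  totally_real R L ->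
  indexes_places emb ->
  forall w : P -> P -> R, wedge2_LOG_units emb w ->
  w <> (fun _ _ => 0) ->
  2 * ln ((1 + Num.sqrt 5) / 2) * ln (1 + Num.sqrt 2) <= wedge_l1norm w.
Proof.
move=> _ galL /isogP[phi inj_phi _] _ [emb_inj emb_surj] w Ww w_neq0.
have antiw := wedge2_LOG_units_anti Ww.
have [[p0 _]|noP] := boolp.pselect (exists p : P, True); last first.
  by case: w_neq0; apply: boolp.funext => u; case: noP; exists u.
move: (emb p0) => f.
(* With [f] as base point, the places are identified with the Galois group by the mutually inverse
   maps [k] and [k']. *)
have [k kE] : exists k : P -> gal_of {:L}, forall u x, emb u x = f (k u x).
  exact: fin_all_exists (fun u => embedding_galois_conj f (emb u) galL).
have [k' k'E] : exists k' : gal_of {:L} -> P, forall g x, emb (k' g) x = f (g x).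
  suff k'_ex (g : gal_of {:L}) : exists p, forall x, emb p x = f (g x).
    exact: fin_all_exists k'_ex.
  by have [p pE] := emb_surj (f \o g); exists p => x; rewrite pE.
have kK : cancel k k' by move=> u; apply: emb_inj => x; rewrite k'E -kE.
have k'K : cancel k' k.
  move=> g; apply/eqP; apply/gal_eqP => x _; apply: (fmorph_inj f).
  by rewrite -kE k'E.
pose c a (g : gal_of {:L}) : R := chi R a (phi g).
have qc a : quadratic_character (c a).
  split=> [g|g h]; first exact: chi_pm1.
  by rewrite /c morphM ?mem_gal1 // chiD.
have h_inj : injective (fun u => phi (k u)).
  by move=> u v /(injmP inj_phi); rewrite !mem_gal1 => /(_ isT isT)/(can_inj kK).
pose X a u := c a (k u).
have XLOG a e : unit_of_OL e -> \sum_u X a u * LOG emb e u = 2 * logrel f (c a) e.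
  move=> ue; rewrite -(character_pairing f galL (qc a) ue).
  rewrite (reindex k') /=; last by exists k => ? _.
  by apply: eq_bigr => g _; rewrite /X /LOG k'K k'E.
have [[a [b Tab]]|T0] := boolp.pselect (exists a b, wpair (X a) (X b) w != 0); last first.
  case: w_neq0; apply: boolp.funext => u; apply: boolp.funext => v.
  (* If all pairings vanish, Fourier inversion in [v] and then in [u] gives w = 0. *)
  move: v; apply: (chi_separates h_inj) => b; move: u.
  apply: (chi_separates h_inj) => a.
  transitivity (wpair (X a) (X b) w).
    rewrite /wpair; apply: eq_bigr => u _; rewrite mulr_suml; apply: eq_bigr => v _.
    by rewrite -mulrA [X in w u v * X]mulrC.
  by apply/eqP/negPn/negP => Tab; apply: T0; exists a, b.
(* Equal characters would pair to 0 with the antisymmetric [w]. *)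
have cab : exists g, c a g != c b g.
  have [//|noG] := boolp.pselect (exists g, c a g != c b g).
  case/eqP: Tab; have -> : X a = X b; last exact: wpair_diag.
  apply: boolp.funext => u; apply/eqP/negPn/negP => h; apply: noG; by exists (k u).
have [e1 u1 gen1] := logrel_cyclic f galL (qc a).
have [e2 u2 gen2] := logrel_cyclic f galL (qc b).
(* On generators the pairing is a determinant of integer multiples of the two cyclic generators; the
   factor 4 comes from the two factors 2 in [XLOG]. *)
have [m TE] : exists m : int,
    wpair (X a) (X b) w = m%:~R * (4 * (logrel f (c a) e1 * logrel f (c b) e2)).
  elim: Ww => [x y ux uy | | w1 w2 _ [m1 IH1] _ [m2 IH2]].
  - rewrite wpair_wedge2 !XLOG //.
    have [i ->] := gen1 x ux; have [j ->] := gen1 y uy.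
    have [i' ->] := gen2 x ux; have [j' ->] := gen2 y uy.
    by exists (i * j' - j * i'); rewrite rmorphB !rmorphM /=; ring.
  - exists 0; rewrite mul0r /wpair; apply: big1 => u _; apply: big1 => v _.
    by rewrite mul0r.
  - by exists (m1 - m2); rewrite wpairB IH1 IH2 rmorphB /=; ring.
have := Tab; rewrite TE !mulf_eq0 !negb_or intr_eq0 => /and4P[m0 _ n1 n2].
have X1 a' u : `|X a' u| = 1.
  by have [cE _] := qc a'; rewrite /X; case: (cE (k u)) => ->; rewrite ?normrN normr1.
have := wpair_le antiw (X1 a) (X1 b).
rewrite TE !normrM (ger0_norm (ler0n _ 4)).
have := logrel_mul_ge galL (qc a) (qc b) cab u1 u2 n1 n2.
(* Since [m] is a nonzero integer, 4 times the product of the two logarithms in absolute value is at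
   most |T|, hence at most twice the l1 norm. *)
have m1 : 1 <= `|m%:~R| :> R by rewrite -intr_norm ler1z; lia.
set A := `|logrel _ _ _| * _ => le_BA le_AN; rewrite -mulrA.
rewrite -(ler_pM2l (ltr0n R 2)) (le_trans _ le_AN) //.
have -> x : 2 * (2 * x) = 4 * x :> R by ring.
apply: (@le_trans _ _ (4 * A)); first by rewrite ler_wpM2l.
by apply: ler_peMl => //; rewrite !mulr_ge0.
Qed.
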